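(* Let $n\ge 3$. For a simple undirected graph $G$ on vertex set $[n]$ let $\langle\langle G\rangle\rangle\subseteq\mathcal{A}_n$ be the set of symbols $(ij|K)$ such that $K$ separates $i$ and $j$ in $G$, and let $G^c$ be the complement graph of $G$. The map $G\mapsto\langle\langle G\rangle\rangle$ is a bijection from the set of simple undirected graphs on $[n]$ to the set of $n$-dimensional gaussoids in the class $\mathtt{EUBF}$. The ($n$-dimensional parts of the) subclasses are described as follows: (1) $\mathtt{EUB}$ contains exactly the gaussoids $\langle\langle G\rangle\rangle$ such that $G^c$ is $K_3$-free (contains no triangle). (2) $\mathtt{UBF}$ contains exactly the gaussoids $\langle\langle G\rangle\rangle$ such that each connected component of $G$ is a path (a single vertex counts as a path). (3) $\mathtt{EUF}$ contains exactly the gaussoids $\langle\langle G\rangle\rangle$ such that each connected component of $G^c$ is a clique (and hence these gaussoids correspond to partitions of the vertex set $[n]$). (4) $\mathtt{EU}$ contains exactly the gaussoids $\langle\langle G\rangle\rangle$ such that each connected component of $G^c$ is a clique and has at most two vertices.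
   Context: Notation: $[n]=\{1,\dots,n\}$; unions of subsets and elements of $[n]$ are written by concatenation, e.g. $ijL=\{i\}\cup\{j\}\cup L$. $\mathcal{A}_n$ is the set of symbols $(ij|K)$ with $i\ne j$ in $[n]$ and $K\subseteq[n]\setminus\{i,j\}$, where $(ij|K)=(ji|K)$; they index the squares ($2$-faces) of the $n$-cube. We write $(ij|)$ for $(ij|\emptyset)$. $3$-minors: For pairwise distinct $i,j,k\in[n]$ and $L\subseteq[n]\setminus\{i,j,k\}$, the $(ijk|L)$-minor of $\mathcal{A}\subseteq\mathcal{A}_n$ is the set of symbols $(ab|K)$ with $\{a,b\}\cup K\subseteq\{i,j,k\}$ such that $(ab|KL)\in\mathcal{A}$. Types of $3$-gaussoids: on a three-element ground set $\{i,j,k\}$ there are six symbols: $(ij|),(ik|),(jk|),(ij|k),(ik|j),(jk|i)$. The eleven $3$-gaussoids fall into five types: $\mathtt{E}$: the empty set; $\mathtt{L}$ (lower singletons): $\{(ij|)\}$, $\{(ik|)\}$, $\{(jk|)\}$; $\mathtt{U}$ (upper singletons): $\{(ij|k)\}$, $\{(ik|j)\}$, $\{(jk|i)\}$; $\mathtt{B}$ (belts): the three four-element sets obtained by removing one opposite pair, i.e. removing $\{(ij|),(ij|k)\}$, or $\{(ik|),(ik|j)\}$, or $\{(jk|),(jk|i)\}$; $\mathtt{F}$: the full set of all six symbols. A string of letters from $\{\mathtt{E},\mathtt{L},\mathtt{U},\mathtt{B},\mathtt{F}\}$ denotes the class of all sets $\mathcal{A}\subseteq\mathcal{A}_n$,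 $n\ge3$, all of whose $3$-minors are of one of the listed types (all such sets are gaussoids). Separation: for distinct vertices $i,j$ of $G$ and $K\subseteq[n]\setminus\{i,j\}$, $K$ separates $i$ and $j$ if every path in $G$ between $i$ and $j$ contains a vertex of $K$. *)

(* Defs.v *)
From mathcomp Require Import all_boot.
From mathcomp Require Import boolp.

Set Implicit Arguments.
Unset Strict Implicit.
Unset Printing Implicit Defensive.

Section Gaussoids.
Variable n : nat.
Implicit Types (i j k : 'I_n) (K L : {set 'I_n}).

(* The symbol (ij|K) is the pair ({i,j}, K), so that (ij|K) = (ji|K). *)
Definition symbol : finType := ({set 'I_n} * {set 'I_n})%type.

Definition sym i j K : symbol := ([set i; j], K).

(* The set A_n; arbitrary terms of type [symbol] may be degenerate. *)
Definition symbols : {set symbol} :=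
  [set s : symbol | (#|s.1| == 2) && [disjoint s.1 & s.2]].

(* The minor is kept inside the ambient ground set instead of being
   transported to a three-element type. *)
Definition minor3 (A : {set symbol}) i j k L : {set symbol} :=
  [set s in symbols | (s.1 :|: s.2 \subset [set i; j; k])
                      && ((s.1, s.2 :|: L) \in A)].

Inductive letter := LetE | LetL | LetU | LetB | LetF.

Definition full3 i j k : {set symbol} :=
  [set sym i j set0; sym i k set0; sym j k set0;
       sym i j [set k]; sym i k [set j]; sym j k [set i]].

Definition gaussoids3 (t : letter) i j k : {set {set symbol}} :=
  match t with
  | LetE => [set set0]
  | LetL => [set [set sym i j set0]; [set sym i k set0]; [set sym j k set0]]
  | LetU => [set [set sym i j [set k]]; [set sym i k [set j]];
                 [set sym j k [set i]]]
  | LetB => [set full3 i j k :\: [set sym i j set0; sym i j [set k]];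
                 full3 i j k :\: [set sym i k set0; sym i k [set j]];
                 full3 i j k :\: [set sym j k set0; sym j k [set i]]]
  | LetF => [set full3 i j k]
  end.

Definition in_class (ts : seq letter) (A : {set symbol}) : Prop :=
  A \subset symbols /\
  forall i j k L, uniq [:: i; j; k] -> [disjoint L & [set i; j; k]] ->
    has (fun t => minor3 A i j k L \in gaussoids3 t i j k) ts.

(* The gaussoid axioms of Lnenicka and Matus. *)
Definition gaussoid (A : {set symbol}) : Prop :=
  A \subset symbols /\
  forall i j k L, uniq [:: i; j; k] -> [disjoint L & [set i; j; k]] ->
  [/\ sym i j L \in A -> sym i k (j |: L) \in A ->
        sym i k L \in A /\ sym i j (k |: L) \in A,
      sym i j (k |: L) \in A -> sym i k (j |: L) \in A ->
        sym i j L \in A /\ sym i k L \in A,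
      sym i j L \in A -> sym i k L \in A ->
        sym i j (k |: L) \in A /\ sym i k (j |: L) \in A
    & sym i j L \in A -> sym i j (k |: L) \in A ->
        sym i k L \in A \/ sym j k L \in A].

(* A simple undirected graph is its edge set, so that equality of graphs is
   Leibniz equality. *)
Record sgraph := SGraph {
  edges : {set {set 'I_n}};
  edges_card2 : [forall e in edges, #|e| == 2] }.

(* Irreflexive: [set i; i] has cardinality 1. *)
Definition adj (G : sgraph) : rel 'I_n := fun i j => [set i; j] \in edges G.

Lemma compl_card2 (G : sgraph) :
  [forall e in [set e : {set 'I_n} | (#|e| == 2) && (e \notin edges G)],
    #|e| == 2].
Proof. by apply/forall_inP => e; rewrite inE => /andP[]. Qed.

Definition compl (G : sgraph) : sgraph := SGraph (compl_card2 G).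

(* The vertex sequence of a path from i to j is i :: p. *)
Definition separates (G : sgraph) K i j : Prop :=
  forall p : seq 'I_n, path (adj G) i p -> uniq (i :: p) -> last i p = j ->
    exists2 v, v \in i :: p & v \in K.

(* The set <<G>>; [asbool] makes the proposition about paths a boolean, so that
   it can carve out a finite set. *)
Definition sep_gaussoid (G : sgraph) : {set symbol} :=
  [set s in symbols |
    `[< exists i j, s.1 = [set i; j] /\ separates G s.2 i j >]].

Definition components (G : sgraph) : {set {set 'I_n}} :=
  equivalence_partition (connect (adj G)) [set: 'I_n].

Definition triangle_free (G : sgraph) : Prop :=
  ~ exists i j k, [/\ adj G i j, adj G j k & adj G i k].

Definition is_clique (G : sgraph) (C : {set 'I_n}) : Prop :=
  {in C &, forall i j, i != j -> adj G i j}.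

(* The subgraph of G induced on C is a path graph, s listing its vertices in
   order. *)
Definition induces_path (G : sgraph) (C : {set 'I_n}) : Prop :=
  exists s : seq 'I_n, [/\ uniq s, C =i s &
    {in C &, forall i j, adj G i j =
       ((index i s).+1 == index j s) || ((index j s).+1 == index i s)}].

(* If A = <<G>> and every component of the complement of G is a clique, then G
   is the complete multipartite graph whose parts are the blocks of P. *)
Definition partition_of (A : {set symbol}) (P : {set {set 'I_n}}) : Prop :=
  partition P [set: 'I_n] /\
  exists2 G, A = sep_gaussoid G & components (compl G) = P.

End Gaussoids.

(* Main.v *)
Require Import Defs.
From mathcomp Require Import all_boot.
From mathcomp Require Import boolp.

Set Implicit Arguments.
Unset Strict Implicit.
Unset Printing Implicit Defensive.

(** Write a_xy for (xy|L) in A and b_xy for (xy|zL) in A, where z is the third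
    element of the minor.  Listing the eleven 3-gaussoids shows that no minor
    of A is a lower singleton exactly when A satisfies three closure rules:
    a_ij implies b_ij (ascension), b_ij and b_ik imply a_ij (intersection), and
    a_ij implies a_ik or a_kj (transitivity).  These are the rules of Pearl and
    Paz for graph separation, and such a set is called [graphlike] below.
    Moreover, under these rules the letter of a minor is determined by how many
    of its upper symbols b_ij, b_ik, b_jk are in A: 0, 1, 2, 3 of them for
    E, U, B, F ([in_class_upper]).

    A graphlike A is <<G>> for the graph G whose edges are the pairs ij with
    (ij|rest) not in A ([graphlike_sep]).  If (ij|K) is in A, no path from i to
    j avoids K: for a first step from i to v, transitivity gives (iv|K) or
    (vj|K) in A; the first would ascend to (iv|rest) and contradict the edge
    iv, the second is excluded by induction along the path.  Conversely, let K
    separate i from j, and induct on the size of the complement of K.  Any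
    further vertex k is separated by K from one of i and j, say from i; then
    kK separates i from j and jK separates i from k, so (ij|kK) and (ik|jK) are
    in A, and intersection gives (ij|K).  As the symbols (ij|rest) determine
    the edges, G is unique ([sep_gaussoid_inj]).

    The subclasses are read off the numbers of upper symbols.  In the minor of
    i, j, k with L everything else, this number counts the edges of the
    complement graph among i, j, k ([upper_count_top]).  Excluding F therefore
    forbids triangles in the complement, and excluding B makes non-adjacency
    transitive, that is, makes the components of the complement cliques; in
    both cases the top minors force all the others.  Excluding E says, for L
    empty, that among any three vertices one separates the other two.  This
    forbids claws, so a maximal path in a component can only be left from its
    ends and hence spans the component, and it forbids chords of that path.
    In a path, conversely, the middle one of three vertices separates the other
    two. *)

(** * Three-element minors as bit vectors *)

Section Minors.
Variable n : nat.
Implicit Types (A : {set symbol n}) (i j k : 'I_n) (K L : {set 'I_n}).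

Lemma symC i j K : sym i j K = sym j i K.
Proof. by rewrite /sym setUC. Qed.

Lemma sym_symbols i j K :
  (sym i j K \in symbols n) = [&& i != j, i \notin K & j \notin K].
Proof.
rewrite inE /sym /= cards2 disjoints_subset subUset !sub1set !inE.
by case: (i == j).
Qed.

(** A boolean form of the side conditions on the index of a minor, whose
    conjuncts are convenient to split and to permute. *)
Definition minor_at i j k L :=
  [&& i != j, i != k, j != k, i \notin L, j \notin L & k \notin L].

Lemma minor_atP i j k L :
  reflect (uniq [:: i; j; k] /\ [disjoint L & [set i; j; k]])
          (minor_at i j k L).
Proof.
rewrite disjoint_sym disjoints_subset !subUset !sub1set /= !inE /minor_at.
by apply: (iffP idP) => [|[]];
   case: eqP => //=; case: eqP => //=; case: eqP => //= _ _ _;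
   rewrite -?andbA.
Qed.

Definition symbols3 i j k : seq (symbol n) :=
  [:: sym i j set0; sym i k set0; sym j k set0;
      sym i j [set k]; sym i k [set j]; sym j k [set i]].

Lemma symbols3_uniq i j k L : minor_at i j k L -> uniq (symbols3 i j k).
Proof.
case/and4P=> ij ik jk _.
have pairN x y z : y != z -> x != y -> ([set x; y] == [set x; z]) = false.
  move=> yz xy; apply/negbTE/eqP => /setP/(_ y).
  by rewrite !inE eqxx orbT eq_sym (negbTE xy) (negbTE yz).
have e1 : ([set i; j] == [set i; k]) = false by apply: pairN.
have e2 : ([set i; j] == [set j; k]) = false.
  by rewrite setUC pairN // eq_sym.
have e3 : ([set i; k] == [set j; k]) = false.
  by rewrite ![[set _; k]]setUC pairN // eq_sym.
have s0 x : (set0 == [set x]) = false by apply/negbTE; rewrite eq_sym -cards_eq0 cards1.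
by rewrite /= !inE /sym !xpair_eqE !eqxx /= e1 e2 e3 !s0 /= ?andbF.
Qed.

(** The entries of a pair in the minor lie in {i, j, k}, so its first component
    is one of the three pairs and its second is empty or the third element. *)
Lemma minor3_sub A i j k L : {subset minor3 A i j k L <= symbols3 i j k}.
Proof.
case=> e K; rewrite inE inE /= => /andP[/andP[c2 dj] /andP[+ _]].
case/cards2P: c2 dj => x [y [xy ->]] dj.
rewrite subUset => /andP[].
rewrite !subUset !sub1set !inE => /andP[hx hy] /subsetP sK.
have K1 z : (forall w, w \in K -> w = z) -> K = set0 \/ K = [set z].
  move=> h; have : K \subset [set z] by apply/subsetP=> w /h->; rewrite inE.
  by rewrite subset1 => /orP[/eqP|/eqP]; [right|left].
move: dj; rewrite disjoints_subset subUset !sub1set !inE => /andP[xK yK].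
have K2 z : (forall w, [|| w == i, w == j | w == k] -> w != x -> w != y ->
    w = z) -> K = set0 \/ K = [set z].
  move=> h; apply: K1 => w wK; apply: h.
  - by move: (sK w wK); rewrite !inE orbA.
  - by apply: contraNneq xK => <-.
  - by apply: contraNneq yK => <-.
case/orP: hx => [/orP[]|] /eqP ex; case/orP: hy => [/orP[]|] /eqP ey; subst x y;
  move: xy; rewrite ?eqxx // => _.
- case: (K2 k) => [w /or3P[]/eqP->|->|->]; rewrite ?eqxx ?orbT //.
- case: (K2 j) => [w /or3P[]/eqP->|->|->]; rewrite ?eqxx ?orbT //.
- case: (K2 k) => [w /or3P[]/eqP->|->|->]; rewrite ?eqxx //;
    by rewrite -!/(sym _ _ _) symC ?eqxx ?orbT.
- case: (K2 i) => [w /or3P[]/eqP->|->|->]; rewrite ?eqxx ?orbT //.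
- case: (K2 j) => [w /or3P[]/eqP->|->|->]; rewrite ?eqxx //;
    by rewrite -!/(sym _ _ _) symC ?eqxx ?orbT.
- case: (K2 i) => [w /or3P[]/eqP->|->|->]; rewrite ?eqxx //;
    by rewrite -!/(sym _ _ _) symC ?eqxx ?orbT.
Qed.

(** The order of the bits is that of [symbols3]: the three lower symbols, then
    the three upper ones, each block in the order ij, ik, jk. *)
Lemma minor3_bits A i j k L : minor_at i j k L ->
  [seq s \in minor3 A i j k L | s <- symbols3 i j k] =
  [seq s \in A | s <- [:: sym i j L; sym i k L; sym j k L;
      sym i j (k |: L); sym i k (j |: L); sym j k (i |: L)]].
Proof.
case/and5P=> ij ik jk iL /andP[jL kL].
have E x y K : sym x y K \in symbols n ->
    [set x; y] :|: K \subset [set i; j; k] ->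
    (sym x y K \in minor3 A i j k L) = (sym x y (K :|: L) \in A).
  by move=> h1 h2; rewrite inE h1 h2.
rewrite /= !E ?set0U // ?sym_symbols ?subUset ?sub1set ?sub0set !inE ?eqxx
  ?orbT //= ?ij ?ik ?jk //= ?(eq_sym k) ?(eq_sym j) ?ij ?ik ?jk //=;
 by rewrite eq_sym.
Qed.

Lemma eq_set_bits (T : finType) (l : seq T) (X Y : {set T}) :
  {subset X <= l} -> {subset Y <= l} ->
  (X == Y) = ([seq s \in X | s <- l] == [seq s \in Y | s <- l]).
Proof.
move=> sX sY; apply/eqP/eqP => [->//|/eq_in_map E]; apply/setP=> s.
have [/E//|sl] := boolP (s \in l).
by rewrite (contraNF (sX s)) // (contraNF (sY s)).
Qed.

Definition letter_bits t : seq (seq bool) :=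
  match t with
  | LetE => [:: [:: false; false; false; false; false; false]]
  | LetL => [:: [:: true; false; false; false; false; false];
                [:: false; true; false; false; false; false];
                [:: false; false; true; false; false; false]]
  | LetU => [:: [:: false; false; false; true; false; false];
                [:: false; false; false; false; true; false];
                [:: false; false; false; false; false; true]]
  | LetB => [:: [:: false; true; true; false; true; true];
                [:: true; false; true; true; false; true];
                [:: true; true; false; true; true; false]]
  | LetF => [:: [:: true; true; true; true; true; true]]
  end.

(* Evaluates the equality tests between symbols known to be distinct. *)
Ltac decide_distinct := repeat (match goal with
  | H : (?x == ?y) = false |- context [?x == ?y] => rewrite H
  | H : (?x == ?y) = false |- context [?y == ?x] => rewrite (eq_sym y x) H
  end; rewrite /=).

(** Turns membership in a list of concrete 3-gaussoids into a comparison of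
    booleans, so that the types can be analysed by truth tables. *)
Lemma gaussoids3_bits t i j k L (X : {set symbol n}) : minor_at i j k L ->
  {subset X <= symbols3 i j k} ->
  (X \in gaussoids3 t i j k) =
  ([seq s \in X | s <- symbols3 i j k] \in letter_bits t).
Proof.
move=> /symbols3_uniq; rewrite /gaussoids3 /full3 /symbols3.
move: (sym i j set0) (sym i k set0) (sym j k set0)
  (sym i j [set k]) (sym i k [set j]) (sym j k [set i]) => a b c d e f.
move=> u sX.
move: u; rewrite /= !inE !negb_or -!andbA.
do 15![case/andP=> /negbTE ?]; move=> _.
have bits_of (Y : {set symbol n}) bs :
    (forall s, s \in Y ->
       [|| s == a, s == b, s == c, s == d, s == e | s == f]) ->
    [:: a \in Y; b \in Y; c \in Y; d \in Y; e \in Y; f \in Y] = bs ->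
    (X == Y) = ([seq s \in X | s <- [:: a; b; c; d; e; f]] == bs).
  by move=> sY <-; apply: eq_set_bits sX _ => s /sY; rewrite !inE.
case: t; rewrite !inE -?orbA.
all: repeat congr (_ || _).
all: apply: bits_of => [s|];
  rewrite !inE ?eqxx /=; try decide_distinct => //;
  by do 6?case: (s == _).
Qed.

End Minors.

(** * Sets without lower minors *)

Section Graphlike.
Variable n : nat.
Implicit Types (A : {set symbol n}) (i j k : 'I_n) (K L : {set 'I_n}).

(** Known for graphoids as strong union. *)
Definition ascending A := forall i j k L, minor_at i j k L ->
  sym i j L \in A -> sym i j (k |: L) \in A.

Definition intersective A := forall i j k L, minor_at i j k L ->
  sym i j (k |: L) \in A -> sym i k (j |: L) \in A -> sym i j L \in A.

Definition transitive_sym A := forall i j k L, minor_at i j k L ->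
  sym i j L \in A -> (sym i k L \in A) || (sym k j L \in A).

Definition graphlike A :=
  [/\ A \subset symbols n, ascending A, intersective A & transitive_sym A].

Lemma minor_atC i j k L : minor_at i j k L -> minor_at j i k L.
Proof.
case/and5P=> ij ik jk iL /andP[jL kL].
by rewrite /minor_at eq_sym ij ik jk iL jL.
Qed.

Lemma minor_atCr i j k L : minor_at i j k L -> minor_at i k j L.
Proof.
case/and5P=> ij ik jk iL /andP[jL kL].
by rewrite /minor_at (eq_sym k) ij ik jk iL kL jL.
Qed.

Definition upper_count A i j k L : nat :=
  (sym i j (k |: L) \in A) + (sym i k (j |: L) \in A) + (sym j k (i |: L) \in A).

(** Common to all 3-gaussoids of a type.  It determines the type except that E
    and L agree, which is why lower singletons are ruled out first. *)
Definition upper_number t :=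
  match t with LetE => 0 | LetL => 0 | LetU => 1 | LetB => 2 | LetF => 3 end.

Definition not_lower t := if t is LetL then false else true.

Definition graphlike_bits a1 a2 a3 b1 b2 b3 :=
  [&& a1 ==> b1, a2 ==> b2, a3 ==> b3,
      b1 && b2 ==> a1 && a2, b1 && b3 ==> a1 && a3, b2 && b3 ==> a2 && a3,
      a1 ==> a2 || a3, a2 ==> a1 || a3 & a3 ==> a1 || a2].

(** The truth table behind the classification: among the 3-gaussoids other than
    the lower singletons, the number of upper symbols tells the types apart. *)
Lemma letter_bitsE t a1 a2 a3 b1 b2 b3 : not_lower t ->
  ([:: a1; a2; a3; b1; b2; b3] \in letter_bits t) =
  graphlike_bits a1 a2 a3 b1 b2 b3 && (b1 + b2 + b3 == upper_number t).
Proof.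
by case: t => // _; case: a1; case: a2; case: a3; case: b1; case: b2; case: b3.
Qed.

Lemma minor3_letter A t i j k L : not_lower t -> minor_at i j k L ->
  (minor3 A i j k L \in gaussoids3 t i j k) =
  graphlike_bits (sym i j L \in A) (sym i k L \in A) (sym j k L \in A)
    (sym i j (k |: L) \in A) (sym i k (j |: L) \in A) (sym j k (i |: L) \in A)
  && (upper_count A i j k L == upper_number t).
Proof.
move=> tL m; rewrite (gaussoids3_bits t m (@minor3_sub _ A i j k L)).
by rewrite (minor3_bits A m) letter_bitsE.
Qed.

(** The three rules at the six orderings of i, j, k yield the nine implications
    between the bits. *)
Lemma graphlike_minor A i j k L : graphlike A -> minor_at i j k L ->
  graphlike_bits (sym i j L \in A) (sym i k L \in A) (sym j k L \in A)
    (sym i j (k |: L) \in A) (sym i k (j |: L) \in A) (sym j k (i |: L) \in A).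
Proof.
case=> _ asc int tr m.
have m1 := minor_atC m; have m2 := minor_atCr m.
have m3 := minor_atC m2; have m4 := minor_atCr m1; have m5 := minor_atC m4.
rewrite /graphlike_bits; apply/and5P; split; last apply/and5P; try split.
- by apply/implyP; apply: asc m.
- by apply/implyP; apply: asc m2.
- by apply/implyP; apply: asc m4.
- by apply/implyP=> /andP[x y]; rewrite (int _ _ _ _ m) ?(int _ _ _ _ m2).
- apply/implyP=> /andP[]; rewrite !(symC i j) => x y.
  by rewrite (int _ _ _ _ m1) ?(int _ _ _ _ m4).
- apply/implyP=> /andP[]; rewrite !(symC i k) !(symC j k) => x y.
  by rewrite (int _ _ _ _ m3) ?(int _ _ _ _ m5).
- by apply/implyP; rewrite (symC j k); apply: tr m.
- by apply/implyP; apply: tr m2.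
- by apply/implyP; rewrite (symC i j); apply: tr m4.
Qed.

(** The closure rules express that no minor is a lower singleton; beyond them,
    membership in a class only restricts the numbers of upper symbols. *)
Lemma in_class_upper A ts : all not_lower ts ->
  in_class ts A <-> graphlike A /\ forall i j k L, minor_at i j k L ->
    upper_count A i j k L \in map upper_number ts.
Proof.
move=> tsL.
have E i j k L : minor_at i j k L ->
    has (fun t => minor3 A i j k L \in gaussoids3 t i j k) ts =
    graphlike_bits (sym i j L \in A) (sym i k L \in A) (sym j k L \in A)
      (sym i j (k |: L) \in A) (sym i k (j |: L) \in A)
      (sym j k (i |: L) \in A)
    && (upper_count A i j k L \in map upper_number ts).
  move=> m; elim: ts tsL => [|t ts IH] /=; first by rewrite andbF.
  by case/andP=> tL /IH->; rewrite minor3_letter // inE -andb_orr.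
split=> [[As cA]|[gA cA]].
  have {}cA i j k L : minor_at i j k L -> _ := fun m =>
    let: conj u d := elimT (minor_atP i j k L) m in cA i j k L u d.
  split; last by move=> i j k L m; have:= cA _ _ _ _ m; rewrite E // => /andP[].
  split=> // i j k L m; have:= cA _ _ _ _ m; rewrite E // => /andP[+ _];
    rewrite /graphlike_bits ?(symC j k L);
    do 6?case: (_ \in A) => //.
split=> [|i j k L u d]; first by case: gA.
have m : minor_at i j k L by apply/minor_atP.
by rewrite E // cA // graphlike_minor.
Qed.

Lemma upper_count_EUBF A i j k L :
  upper_count A i j k L \in map upper_number [:: LetE; LetU; LetB; LetF].
Proof. by rewrite /upper_count; do 3![case: (_ \in A)]. Qed.

Lemma graphlike_EUBF A :
  in_class [:: LetE; LetU; LetB; LetF] A <-> graphlike A.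
Proof.
rewrite in_class_upper //.
by split=> [[]|gA] //; split=> // i j k L _; apply: upper_count_EUBF.
Qed.

(** The first gaussoid axiom follows by ascending its first premise and applying
    intersection; the other three are weakenings of the closure rules. *)
Lemma graphlike_gaussoid A : graphlike A -> gaussoid A.
Proof.
case=> As asc int tr; split=> // i j k L u d.
have m : minor_at i j k L by apply/minor_atP.
have m2 := minor_atCr m.
have int2 x y : _ := conj (int _ _ _ _ m x y) (int _ _ _ _ m2 y x).
split.
- move=> /(asc _ _ _ _ m) x y; split=> //; exact: int y x.
- exact: int2.
- by move=> /(asc _ _ _ _ m) ? /(asc _ _ _ _ m2).
- by move=> x _; apply/orP; rewrite (symC j k); apply: tr x.
Qed.

Lemma in_class_EUB A : in_class [:: LetE; LetU; LetB] A <->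
  graphlike A /\ forall i j k L, minor_at i j k L -> upper_count A i j k L != 3.
Proof.
rewrite in_class_upper //; split=> -[gA c]; split=> // i j k L /c;
  by rewrite /upper_count; do 3![case: (_ \in A)].
Qed.

Lemma in_class_UBF A : in_class [:: LetU; LetB; LetF] A <->
  graphlike A /\ forall i j k L, minor_at i j k L -> upper_count A i j k L != 0.
Proof.
rewrite in_class_upper //; split=> -[gA c]; split=> // i j k L /c;
  by rewrite /upper_count; do 3![case: (_ \in A)].
Qed.

Lemma in_class_EUF A : in_class [:: LetE; LetU; LetF] A <->
  graphlike A /\ forall i j k L, minor_at i j k L -> upper_count A i j k L != 2.
Proof.
rewrite in_class_upper //; split=> -[gA c]; split=> // i j k L /c;
  by rewrite /upper_count; do 3![case: (_ \in A)].
Qed.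

Lemma in_class_EU A : in_class [:: LetE; LetU] A <->
  in_class [:: LetE; LetU; LetB] A /\ in_class [:: LetE; LetU; LetF] A.
Proof.
rewrite in_class_EUB in_class_EUF in_class_upper //; split=> [[gA c]|[[gA c] [_ d]]];
  do ?split=> //; move=> i j k L m; move: (c _ _ _ _ m); last move: (d _ _ _ _ m);
  by rewrite /upper_count; do 3![case: (_ \in A)].
Qed.

End Graphlike.

(** * Separation in graphs *)

Section Separation.
Variable n : nat.
Implicit Types (A : {set symbol n}) (G H : sgraph n) (i j k : 'I_n)
  (K L : {set 'I_n}).

Lemma adjC G i j : adj G i j = adj G j i.
Proof. by rewrite /adj setUC. Qed.

Lemma adj_neq G i j : adj G i j -> i != j.
Proof.
move=> /(forall_inP (edges_card2 G)); rewrite cards2.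
by case: (i != j).
Qed.

Lemma adj_compl G i j : adj (compl G) i j = (i != j) && ~~ adj G i j.
Proof. by rewrite /adj inE cards2; case: (i != j). Qed.

Lemma sgraph_eq G H : adj G =2 adj H -> G = H.
Proof.
case: G H => [E Ec] [F Fc] EF; rewrite /adj /= in EF.
have EqF : E = F.
  apply/setP=> e; have [/cards2P[x [y [_ ->]]]|e2] := boolP (#|e| == 2).
    exact: EF.
  by rewrite (contraNF (forall_inP Ec e)) ?(contraNF (forall_inP Fc e)).
by move: Ec Fc; rewrite EqF => Ec Fc; congr SGraph; apply: bool_irrelevance.
Qed.

(** Connectedness after deletion of K, as a decidable relation whose symmetry
    and transitivity come for free.  The reflexive case makes it meaningful
    only for endpoints outside K. *)
Definition linked G K : rel 'I_n :=
  connect [rel x y | [&& adj G x y, x \notin K & y \notin K]].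

Lemma linkedC G K i j : linked G K i j = linked G K j i.
Proof.
apply: sym_connect_sym => x y /=; rewrite adjC.
by case: (adj G y x) => //=; rewrite andbC.
Qed.

Lemma adj_linked G K i j :
  adj G i j -> i \notin K -> j \notin K -> linked G K i j.
Proof. by move=> ij iK jK; apply: connect1; rewrite /= ij iK. Qed.

Lemma linked_sub G K L i j : K \subset L -> linked G L i j -> linked G K i j.
Proof.
move=> /subsetP KL; apply: connect_sub => x y /= /and3P[xy xL yL].
by apply: adj_linked xy _ _; [apply: contra xL|apply: contra yL]; apply: KL.
Qed.

Lemma avoiding_linked G K i p : path (adj G) i p ->
  (forall v, v \in i :: p -> v \notin K) -> linked G K i (last i p).
Proof.
move=> Gp pK; apply/connectP; exists p => //.
elim: p i Gp pK => //= v p IH i /andP[iv Gp] pK.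
rewrite iv !pK ?inE ?eqxx ?orbT //=; apply: IH => // w wp.
by apply: pK; rewrite inE wp orbT.
Qed.

Lemma linkedP G K i j : i \notin K -> linked G K i j ->
  exists p, [/\ path (adj G) i p, uniq (i :: p), last i p = j &
    forall v, v \in i :: p -> v \notin K].
Proof.
move=> iK /connectP[q rq ->]; case/shortenP: rq => p rp up _; exists p.
elim: p i iK rp up {q} => [|v p IH] i iK /=.
  by move=> _ _; split=> // v; rewrite inE => /eqP->.
case/andP=> /and3P[iv _ vK] rp /andP[ip up].
have [Gp _ _ pK] := IH v vK rp up.
split=> //; rewrite ?iv // ?ip //.
by move=> w; rewrite inE => /predU1P[->|/pK].
Qed.

Lemma separatesE G K i j : i \notin K -> separates G K i j <-> ~~ linked G K i j.
Proof.
move=> iK; split=> [sep|/negP nl p Gp _ lp].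
  apply/negP=> /(linkedP iK)[p [Gp up lp pK]].
  by have [v /pK/negP] := sep p Gp up lp.
apply: contra_notP nl => np; rewrite -lp.
apply: avoiding_linked => // v vp; apply/negP=> vK; apply: np; by exists v.
Qed.

Lemma mem_sep_gaussoid G i j K : sym i j K \in symbols n ->
  (sym i j K \in sep_gaussoid G) = ~~ linked G K i j.
Proof.
move=> s; rewrite inE s; move: s; rewrite sym_symbols => /and3P[ij iK jK].
apply/asboolP/idP => [[x [y [/= e]]]|nl]; last first.
  by exists i, j; split=> //; apply/separatesE.
have: x \in [set i; j] by rewrite e !inE eqxx.
have: y \in [set i; j] by rewrite e !inE eqxx orbT.
have: i \in [set x; y] by rewrite -e !inE eqxx.
have: j \in [set x; y] by rewrite -e !inE eqxx orbT.
rewrite !inE => jxy ixy /orP[]/eqP ey /orP[]/eqP ex; subst x y.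
- by rewrite orbb eq_sym (negbTE ij) in jxy.
- by move/(separatesE _ _ jK); rewrite linkedC.
- by move/(separatesE _ _ iK).
- by rewrite orbb (negbTE ij) in ixy.
Qed.

Lemma sep_gaussoid_sub G : sep_gaussoid G \subset symbols n.
Proof. by apply/subsetP=> s; rewrite inE => /andP[]. Qed.

Lemma minor_at_symbols i j k L : minor_at i j k L ->
  (sym i j L \in symbols n) * (sym i j (k |: L) \in symbols n).
Proof.
case/and5P=> ij ik jk iL /andP[jL kL].
by rewrite !sym_symbols !inE !negb_or ij ik jk iL jL.
Qed.

(** Ascension and transitivity hold because being linked shrinks with deletion
    and is transitive.  For intersection, a simple path from i to j avoiding L
    either avoids k too, or its initial part up to k avoids j. *)
Lemma sep_graphlike G : graphlike (sep_gaussoid G).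
Proof.
split=> [|i j k L m|i j k L m|i j k L m]; first exact: sep_gaussoid_sub.
- have [s1 s2] := minor_at_symbols m.
  by rewrite !mem_sep_gaussoid //; apply/contra/linked_sub/subsetUr.
- have [s1 s2] := minor_at_symbols m.
  have [_ s3] := minor_at_symbols (minor_atCr m).
  case/and5P: (m) => ij ik jk iL /andP[jL kL].
  rewrite !mem_sep_gaussoid // => nij nik.
  apply/negP=> /(linkedP iL)[p [Gp up lp pL]].
  have [kp|kp] := boolP (k \in i :: p); last first.
    case/negP: nij; rewrite -lp; apply: avoiding_linked => // v vp.
    by rewrite !inE negb_or pL // andbT; apply: contraNneq kp => <-.
  move: kp; rewrite inE eq_sym (negbTE ik) /= => kp.
  case/splitPr: kp Gp up lp pL => p1 p2.
  rewrite cat_path /= => /and3P[Gp1 lk _] up.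
  rewrite last_cat /= => lp pL.
  case/negP: nik.
  rewrite -[k](last_rcons i p1); apply: avoiding_linked.
    by rewrite rcons_path Gp1.
  move=> v; rewrite -rcons_cons mem_rcons => vp.
  have vL : v \notin L.
    apply: pL; move: vp; rewrite !inE mem_cat inE.
    by case/or3P=> ->; rewrite ?orbT.
  rewrite !inE negb_or vL andbT; apply: contraTneq vp => ->.
  have jp2 : j \in p2.
    by move: (mem_last k p2); rewrite lp inE (negbTE jk).
  have: uniq ((i :: p1) ++ k :: p2) by [].
  rewrite -cat_rcons cat_uniq => /and3P[_ + _].
  apply: contra => jr; apply/hasP; exists j => //.
  by rewrite -mem_rcons in jr.
- have [s1 s2] := minor_at_symbols m.
  have [s3 _] := minor_at_symbols (minor_atCr m).
  have [s4 _] := minor_at_symbols (minor_atCr (minor_atC m)).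
  rewrite (symC k) !mem_sep_gaussoid // -negb_and; apply: contra => /andP[ik jk].
  by apply: connect_trans ik _; rewrite -/(linked _ _ _ _) linkedC.
Qed.

(** Only the edge ij itself can link i and j once everything else is deleted. *)
Lemma adj_sep G i j : i != j ->
  adj G i j = (sym i j (~: [set i; j]) \notin sep_gaussoid G).
Proof.
move=> ij.
have ni : i \notin ~: [set i; j] by rewrite !inE eqxx.
have nj : j \notin ~: [set i; j] by rewrite !inE eqxx orbT.
rewrite mem_sep_gaussoid ?sym_symbols ?ij ?ni // negbK.
apply/idP/idP=> [ija|]; first exact: adj_linked.
case/connectP=> [[|v p]] /=.
  by move=> _ e; rewrite e eqxx in ij.
case/andP=> /and3P[iv _]; rewrite !inE negbK => /orP[]/eqP ev; subst v.
  by have:= adj_neq iv; rewrite eqxx.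
by [].
Qed.

Lemma sep_gaussoid_inj : injective (@sep_gaussoid n).
Proof.
move=> G H GH; apply: sgraph_eq => i j.
have [->|ij] := eqVneq i j; last by rewrite !adj_sep // GH.
by rewrite !(contraTF (@adj_neq _ j j)) ?eqxx.
Qed.

Lemma graph_of_card2 A :
  [forall e in [set e : {set 'I_n} | (#|e| == 2) && ((e, ~: e) \notin A)],
    #|e| == 2].
Proof. by apply/forall_inP => e; rewrite inE => /andP[]. Qed.

Definition graph_of A : sgraph n := SGraph (graph_of_card2 A).

Lemma adj_graph_of A i j :
  adj (graph_of A) i j = (i != j) && (sym i j (~: [set i; j]) \notin A).
Proof. by rewrite /adj inE cards2; case: (i != j). Qed.

Lemma ascending_subset A i j K L : A \subset symbols n -> ascending A ->
  K \subset L -> sym i j L \in symbols n ->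
  sym i j K \in A -> sym i j L \in A.
Proof.
move=> /subsetP As asc KL; have [m] := ubnP #|L :\: K|.
elim: m K KL => // m IH K KL; rewrite ltnS => card sL sK.
have [/eqP|[k]] := set_0Vmem (L :\: K).
  by rewrite setD_eq0 => LK; have/eqP-> : L == K by rewrite eqEsubset LK.
rewrite inE => /andP[kK kL].
have kKL : k |: K \subset L by rewrite subUset sub1set kL.
apply: (IH (k |: K)) => //.
  apply: leq_trans card; apply: proper_card; apply/properP; split.
    by apply: setDS; apply: subsetUr.
  by exists k; rewrite !inE ?eqxx ?kK.
apply: asc => //; move: sL (As _ sK); rewrite !sym_symbols.
case/and3P=> ij iL jL /and3P[_ iK jK]; rewrite /minor_at ij iK jK kK andbT /=.
by rewrite andbT; apply/andP; split; [apply: contraNneq iL|apply: contraNneq jL] => ->.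
Qed.

(** A path from i to j avoiding K would propagate the symbol (ij|K) along its
    vertices: its first edge iv excludes (iv|K), because this would ascend to
    (iv|rest), so that transitivity leaves (vj|K). *)
Lemma graphlike_linked A i j K : graphlike A ->
  sym i j K \in A -> ~~ linked (graph_of A) K i j.
Proof.
case=> As asc _ tr sK; apply/negP=> /connectP[p rp lp].
elim: p i rp lp sK => [|v p IH] i /=.
  by move=> _ ->; move/(subsetP As); rewrite sym_symbols eqxx.
case/andP=> /and3P[iv iK vK] rp lp sK.
have edge : sym i v K \notin A.
  apply: contraL iv => sv; rewrite adj_graph_of negb_and !negbK orbC.
  apply/orP; left; apply: ascending_subset (sv) => //.
    apply/subsetP=> w wK; rewrite !inE negb_or.
    by apply/andP; split; apply: contraTneq wK => ->.
  by move: (subsetP As _ sv); rewrite !sym_symbols !inE !eqxx orbT => /andP[->].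
have [ev|vj] := eqVneq v j; first by rewrite ev sK in edge.
have : minor_at i j v K.
  move: (subsetP As _ sK); rewrite sym_symbols => /and3P[ij _ jK].
  move: iv; rewrite adj_graph_of => /andP[iv _].
  by rewrite /minor_at ij iv eq_sym vj iK jK.
move=> /tr/(_ sK); rewrite (negbTE edge) /= => svj.
exact: IH svj.
Qed.

(** Downward induction on K, with the definition of the edges as the base case:
    every vertex outside K is separated from i or from j, which lets
    intersection reduce to larger separators. *)
Lemma separated_graphlike A i j K : graphlike A -> sym i j K \in symbols n ->
  ~~ linked (graph_of A) K i j -> sym i j K \in A.
Proof.
case=> As asc int tr; have [m] := ubnP #|~: K|.
elim: m K i j => // m IH K i j; rewrite ltnS => card sK nl.
move: (sK); rewrite sym_symbols => /and3P[ij iK jK].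
have [e|[k]] := set_0Vmem (~: K :\: [set i; j]).
  have EK : K = ~: [set i; j].
    apply/setP=> w; move/setP/(_ w): e; rewrite !inE.
    have [->|_] := eqVneq w i; first by rewrite (negbTE iK).
    have [->|_] := eqVneq w j; first by rewrite (negbTE jK).
    by move/negbFE.
  apply: contraNT nl; rewrite {1}EK => sA; apply: adj_linked => //.
  by rewrite adj_graph_of ij.
rewrite !inE negb_or => /andP[/andP[ki kj] kK].
have mk : minor_at i j k K.
  by rewrite /minor_at ij iK jK kK (eq_sym i) ki eq_sym kj.
have smaller x : x \notin K -> #|~: (x |: K)| < m.
  move=> xK; apply: leq_trans card; apply: proper_card; apply/properP; split.
    by rewrite setCS subsetUr.
  by exists x; rewrite !inE ?eqxx.
(* If K separates x from k then it separates x from y by intersection. *)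
have step x y : minor_at x y k K -> ~~ linked (graph_of A) K x y ->
    ~~ linked (graph_of A) K x k -> sym x y K \in A.
  move=> mx nxy nxk; have [_ s1] := minor_at_symbols mx.
  have [_ s2] := minor_at_symbols (minor_atCr mx).
  case/and5P: (mx) => _ _ _ _ /andP[yK _].
  apply: int mx _ _; apply: IH => //; try exact: smaller;
    by [apply: contra nxy; apply: linked_sub (subsetUr _ _)
       |apply: contra nxk; apply: linked_sub (subsetUr _ _)].
have [ik|] := boolP (linked (graph_of A) K i k); last exact: step.
have [jk|jk] := boolP (linked (graph_of A) K j k).
  case/negP: nl; apply: connect_trans ik _.
  by rewrite -/(linked _ _ _ _) linkedC.
rewrite symC; apply: step => //; first exact: minor_atC.
by rewrite linkedC.
Qed.

Lemma graphlike_sep A : graphlike A -> A = sep_gaussoid (graph_of A).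
Proof.
move=> gA; have As : A \subset symbols n by case: gA.
apply/setP=> s; have [|ns] := boolP (s \in symbols n); last first.
  by rewrite (contraNF (subsetP As s)) // inE (negbTE ns).
case: s => e K; move=> sK; have: #|e| == 2.
  by move: sK; rewrite inE => /andP[].
case/cards2P=> x [y [_ Ee]]; rewrite Ee -/(sym x y K) in sK *.
rewrite mem_sep_gaussoid //; apply/idP/idP; first exact: graphlike_linked.
exact: separated_graphlike.
Qed.

Lemma graphlikeE A : graphlike A <-> exists G, A = sep_gaussoid G.
Proof.
split=> [gA|[G ->]]; last exact: sep_graphlike.
by exists (graph_of A); apply: graphlike_sep.
Qed.

End Separation.

(** * Complements without triangles or with clique components *)

Section Components.
Variable n : nat.
Implicit Types (G H : sgraph n) (i j k : 'I_n) (C : {set 'I_n}).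

Lemma connect_adj_equiv G :
  {in [set: 'I_n] & &, equivalence_rel (connect (adj G))}.
Proof.
move=> x y z _ _ _; split=> [|xy]; first exact: connect0.
have cs : connect_sym (adj G) by apply: sym_connect_sym; apply: adjC.
by rewrite (same_connect cs xy).
Qed.

Lemma components_partition G : partition (components G) [set: 'I_n].
Proof. exact: equivalence_partitionP (@connect_adj_equiv G). Qed.

Lemma mem_component G C i j : C \in components G -> i \in C ->
  (j \in C) = connect (adj G) i j.
Proof.
case/imsetP=> x _ ->; rewrite !inE => xi.
by have [_ /(_ xi)] := @connect_adj_equiv G x i j (in_setT x) (in_setT i) (in_setT j).
Qed.

Lemma component_of G i : exists2 C, C \in components G & i \in C.
Proof.
have /and3P[/eqP cov _ _] := components_partition G.
have /bigcupP[C CG iC] : i \in cover (components G) by rewrite cov in_setT.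
by exists C.
Qed.

Lemma linked_connect G K i j : linked G K i j -> connect (adj G) i j.
Proof. by apply: connect_sub => x y /and3P[xy _ _]; apply: connect1. Qed.

End Components.

Section Subclasses.
Variable n : nat.
Implicit Types (A : {set symbol n}) (G H : sgraph n) (i j k : 'I_n)
  (C K L : {set 'I_n}).

Lemma sep_not_adj G i j K : sym i j K \in sep_gaussoid G -> adj (compl G) i j.
Proof.
move=> sK; have s := subsetP (sep_gaussoid_sub G) _ sK.
move: sK; rewrite mem_sep_gaussoid //; move: s; rewrite sym_symbols adj_compl.
by case/and3P=> -> iK jK; apply: contra => ij; apply: adj_linked.
Qed.

Lemma top_minor i j k : i != j -> i != k -> j != k ->
  minor_at i j k (~: [set i; j; k]).
Proof. by move=> ij ik jk; rewrite /minor_at ij ik jk !inE !eqxx !orbT. Qed.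

(** The minors with the largest possible L see the complement graph directly,
    since their upper symbols are of the form (ij|rest). *)
Lemma upper_count_top G i j k : i != j -> i != k -> j != k ->
  upper_count (sep_gaussoid G) i j k (~: [set i; j; k]) =
  adj (compl G) i j + adj (compl G) i k + adj (compl G) j k.
Proof.
move=> ij ik jk; rewrite !adj_compl ij ik jk /= !adj_sep // !negbK /upper_count.
have D (x y z : 'I_n) : x != z -> y != z ->
    z |: ~: [set x; y; z] = ~: [set x; y].
  move=> xz yz; apply/setP=> w; rewrite !inE !negb_or.
  by have [->|] := eqVneq w z; rewrite ?andbT //= eq_sym xz eq_sym yz.
have Dj : j |: ~: [set i; j; k] = ~: [set i; k].
  by rewrite (setUAC [set i]) D // eq_sym.
have Di : i |: ~: [set i; j; k] = ~: [set j; k].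
  by rewrite -setUA (setUC [set i] [set j; k]) D // eq_sym.
by rewrite D // Dj Di.
Qed.

(** An F minor needs three pairwise non-adjacent vertices, and every such triple
    is visible in its top minor. *)
Lemma EUB_sep G : in_class [:: LetE; LetU; LetB] (sep_gaussoid G) <->
  triangle_free (compl G).
Proof.
rewrite in_class_EUB; split=> [[_ c3] [i [j [k [ij jk ik]]]]|tf].
  have /c3 : minor_at i j k (~: [set i; j; k]).
    by apply: top_minor; [move: ij|move: ik|move: jk]; apply: adj_neq.
  by rewrite upper_count_top ?ij ?ik ?jk //;
    [move: ij|move: ik|move: jk]; apply: adj_neq.
split=> [|i j k L m]; first exact: sep_graphlike.
apply/eqP; rewrite /upper_count.
case ij: (sym i j _ \in _); case ik: (sym i k _ \in _);
  case jk: (sym j k _ \in _) => // _.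
by apply: tf; exists i, j, k; split; [move: ij|move: jk|move: ik];
  apply: sep_not_adj.
Qed.

(** Away from coinciding vertices, this says that non-adjacency in G is
    transitive, that is, that G is complete multipartite. *)
Definition cotransitive G := forall i j k, j != k ->
  adj (compl G) i j -> adj (compl G) i k -> adj (compl G) j k.

(** If j and k remained linked after deletion of i and L, take the first step
    from j to v.  As i is not adjacent to j but v is, i is adjacent to v, so v
    links i to j outside L. *)
Lemma cotransitive_no_belt G i j k L : cotransitive G -> minor_at i j k L ->
  sym i j L \in sep_gaussoid G -> sym j k (i |: L) \in sep_gaussoid G.
Proof.
move=> ct m sij; have aij := sep_not_adj sij.
have [s _] := minor_at_symbols m.
have [_ s'] := minor_at_symbols (minor_atCr (minor_atC m)).
move: sij; rewrite !mem_sep_gaussoid //; apply: contra.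
case/and5P: m => _ _ jk iL /andP[jL _].
case/linkedP; first by move: s'; rewrite sym_symbols => /and3P[].
case=> [|v p] [/=]; first by move=> _ _ e; rewrite e eqxx in jk.
case/andP=> jv _ _ _ /(_ v); rewrite !inE eqxx orbT negb_or.
case/(_ isT)/andP=> vi vL.
have iv : adj G i v.
  apply: contraLR (jv) => niv.
  have /(ct i j v (adj_neq jv) aij) : adj (compl G) i v.
    by rewrite adj_compl eq_sym vi.
  by rewrite adj_compl => /andP[].
apply: connect_trans (adj_linked iv iL vL) _.
by apply: adj_linked; rewrite // adjC.
Qed.

Lemma EUF_sep G : in_class [:: LetE; LetU; LetF] (sep_gaussoid G) <->
  cotransitive G.
Proof.
rewrite in_class_EUF; split=> [[_ c2] i j k jk ij ik|ct].
  have ij' := adj_neq ij; have ik' := adj_neq ik.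
  have := c2 _ _ _ _ (top_minor ij' ik' jk).
  by rewrite upper_count_top // ij ik; case: (adj _ j k).
have gl := sep_graphlike G; split=> // i j k L m.
have:= graphlike_minor gl m; rewrite /upper_count.
have m1 := minor_atC m; have m2 := minor_atCr m; have m4 := minor_atCr m1.
have := cotransitive_no_belt ct (minor_atC m2).
have := cotransitive_no_belt ct m; have := cotransitive_no_belt ct m2.
have := cotransitive_no_belt ct m1; have := cotransitive_no_belt ct m4.
rewrite !(symC j i) !(symC k j) !(symC k i).
by do 6?case: (_ \in sep_gaussoid G).
Qed.

Lemma cotransitive_cliques G : cotransitive G <->
  forall C, C \in components (compl G) -> is_clique (compl G) C.
Proof.
split=> [ct C CG i j iC|cl i j k jk ij ik].
  rewrite (mem_component j CG iC) => /connectP[p Gp ->].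
  elim/last_ind: p Gp => [|p v IH]; first by rewrite eqxx.
  rewrite rcons_path last_rcons => /andP[/IH{}IH lv] iv.
  have [e|] := eqVneq i (last i p); first by rewrite e.
  by move/IH; rewrite adjC => li; apply: ct li lv.
have [C CG iC] := component_of (compl G) i.
by apply: (cl C) => //; rewrite (mem_component _ CG iC) connect1.
Qed.

(** A clique with three vertices is a triangle, so this combines the conditions
    for the two classes whose intersection is EU. *)
Lemma EU_sep G : in_class [:: LetE; LetU] (sep_gaussoid G) <->
  forall C, C \in components (compl G) -> is_clique (compl G) C /\ #|C| <= 2.
Proof.
rewrite in_class_EU EUB_sep EUF_sep cotransitive_cliques.
split=> [[tf cl] C CG|small].
  split; first exact: cl.
  rewrite leqNgt; apply/negP=> /card_gt2P[i [j [k [[iC jC kC] [ij jk ki]]]]].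
  have clC := cl C CG.
  by apply: tf; exists i, j, k; split; apply: clC => //; rewrite eq_sym.
split=> [[i [j [k [ij jk ik]]]]|C /small[]//].
have [C CG iC] := component_of (compl G) i.
have [_] := small C CG; rewrite leqNgt => /negP; apply.
apply/card_gt2P; exists i, j, k; split.
  by split=> //; rewrite (mem_component _ CG iC) connect1.
by rewrite (eq_sym k i); split; [move: ij|move: jk|move: ik];
  apply: adj_neq.
Qed.

End Subclasses.

(** * Graphs whose components are paths *)

Section Paths.
Variable n : nat.
Implicit Types (G : sgraph n) (i j k : 'I_n) (C K L : {set 'I_n})
  (s : seq 'I_n).

(** The condition that the minors with L empty are not of type E. *)
Definition always_between G := forall i j k, i != j -> i != k -> j != k ->
  [|| ~~ linked G [set k] i j, ~~ linked G [set j] i k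
    | ~~ linked G [set i] j k].

Lemma UBF_between G :
  in_class [:: LetU; LetB; LetF] (sep_gaussoid G) -> always_between G.
Proof.
case/in_class_UBF=> _ c0 i j k ij ik jk.
have m : minor_at i j k set0 by rewrite /minor_at ij ik jk !inE.
have [_ sij] := minor_at_symbols m.
have [_ sik] := minor_at_symbols (minor_atCr m).
have [_ sjk] := minor_at_symbols (minor_atCr (minor_atC m)).
move: (c0 _ _ _ _ m); rewrite /upper_count !mem_sep_gaussoid // !setU0.
by do 3?case: (linked _ _ _ _).
Qed.

(** Deleting one leaf of a claw leaves the other two linked through the
    centre. *)
Lemma between_no_claw G u x y w : always_between G ->
  adj G u x -> adj G u y -> adj G u w -> x != y -> x != w -> y != w -> False.
Proof.
move=> bG ux uy uw xy xw yw.
have via a b c : adj G u a -> adj G u b -> adj G u c -> a != c -> b != c ->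
    linked G [set c] a b.
  move=> ua ub uc ac bc; have uc' := adj_neq uc.
  apply: (connect_trans (y := u)); apply: adj_linked; rewrite ?inE //.
  by rewrite adjC.
by have := bG x y w xy xw yw; rewrite !via // eq_sym.
Qed.

Lemma linked_nth G K s x0 c d : sorted (adj G) s -> c <= d -> d < size s ->
  (forall e, c <= e <= d -> nth x0 s e \notin K) ->
  linked G K (nth x0 s c) (nth x0 s d).
Proof.
move=> /(sortedP x0) Gs; elim: d => [|d IH] cd ds sK.
  by move: cd; rewrite leqn0 => /eqP->; apply: connect0.
move: cd; rewrite leq_eqVlt => /predU1P[->|]; first exact: connect0.
rewrite ltnS => cd; apply: connect_trans (IH cd (ltnW ds) _) _.
  by move=> e /andP[ce ed]; apply: sK; rewrite ce leqW.
by apply: adj_linked (Gs _ ds) _ _; apply: sK; rewrite ?leqnSn ?leqnn ?cd ?leqW.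
Qed.

Lemma exit_edge (T : finType) (e : rel T) (s : seq T) x y :
  connect e x y -> x \in s -> y \notin s ->
  exists u w, [/\ u \in s, w \notin s & e u w].
Proof.
case/connectP=> p + ->; elim: p x => [|v p IH] x /=; first by move=> _ ->.
case/andP=> xv ep xs lp; have [vs|vs] := boolP (v \in s).
  exact: IH ep vs lp.
by exists x, v.
Qed.

(** Extend a path for as long as possible.  If it misses a vertex of its
    component, some edge uw leaves it; w can be attached when u is an end of the
    path, and otherwise u, its two neighbours on the path and w form a claw. *)
Lemma between_spanning_path G C : always_between G -> C \in components G ->
  exists s, [/\ uniq s, C =i s & sorted (adj G) s].
Proof.
move=> bG CG.
(* Induction on the number m of vertices possibly still missing. *)
suff grow m s : #|C| < size s + m -> uniq s -> sorted (adj G) s ->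
    s != [::] -> {subset s <= C} ->
    exists t, [/\ uniq t, C =i t & sorted (adj G) t].
  have /set0Pn[x xC] : C != set0.
    apply: contraTneq CG => ->.
    by have /and3P[] := components_partition G.
  apply: (grow #|C| [:: x]) => //.
  by move=> y; rewrite inE => /eqP->.
elim: m s => [|m IH] s.
  rewrite addn0 => lt us _ _ sC; move: lt; rewrite ltnNge.
  by rewrite -(card_uniqP us) subset_leq_card //; apply/subsetP.
move=> lt us Gs s0 sC.
have [Cs|/subsetPn[y yC ys]] := boolP (C \subset s).
  exists s; split=> // x; apply/idP/idP; [exact: (subsetP Cs)|exact: sC].
have [x xs] : exists x, x \in s.
  by case: s s0 {lt us Gs sC ys} => // x s _; exists x; rewrite inE eqxx.
have xy : connect (adj G) x y by rewrite -(mem_component _ CG (sC _ xs)).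
have [u [w [us' ws uw]]] := exit_edge xy xs ys.
have wC : w \in C by rewrite (mem_component _ CG (sC _ us')) connect1.
have longer t : perm_eq t (w :: s) -> sorted (adj G) t ->
    exists t, [/\ uniq t, C =i t & sorted (adj G) t].
  move=> pt Gt; apply: (IH t) => //.
  - by rewrite (perm_size pt) /= addSnnS.
  - by rewrite (perm_uniq pt) /= ws.
  - by rewrite -size_eq0 (perm_size pt).
  - by move=> z; rewrite (perm_mem pt) inE => /predU1P[->|/sC].
case/splitPr: us' Gs us ws longer {lt s0 sC ys xs} => [[|x' s1] s2].
  move=> /= Gs _ _ longer; apply: (longer (w :: u :: s2)) => //=.
  by rewrite adjC uw.
rewrite lastI; set l := last x' s1; set s1' := belast x' s1.
case: s2 => [|z s2] Gs us ws longer.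
  apply: (longer (rcons (rcons s1' l ++ [:: u]) w)).
    by rewrite perm_rcons.
  move: Gs; rewrite cats1; case: (rcons s1' l) => /= [|a r].
    by rewrite uw.
  by rewrite [in X in _ -> X]rcons_path last_rcons uw => ->.
exfalso.
have [_ /= /andP[uz _]] := cat_sorted2 Gs.
have ul : adj G u l.
  by move: Gs; rewrite cat_rcons adjC => /cat_sorted2[_ /= /andP[]].
apply: (@between_no_claw G u l z w) => //.
- move: us; rewrite cat_uniq => /and3P[_ /hasPn/(_ z) + _].
  rewrite !inE eqxx orbT mem_rcons inE negb_or => /(_ isT)/andP[zl _].
  by rewrite eq_sym.
- by apply: contraNneq ws => <-; rewrite mem_cat mem_rcons inE eqxx.
- by apply: contraNneq ws => <-; rewrite mem_cat !inE eqxx !orbT.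
Qed.

(** If i and j were joined by a chord, then i, its successor k and j would be
    three vertices of a cycle, none of which separates the other two. *)
Lemma between_induced G s i j : always_between G -> uniq s ->
  sorted (adj G) s -> i \in s -> j \in s -> index i s < index j s ->
  adj G i j -> (index i s).+1 = index j s.
Proof.
move=> bG us Gs si sj ij aij; apply/eqP.
have js : index j s < size s by rewrite index_mem.
rewrite eqn_leq ij leqNgt; apply/negP=> gap.
set k := nth i s (index i s).+1.
have ks : (index i s).+1 < size s by apply: ltn_trans js.
have Ek : index k s = (index i s).+1 by rewrite index_uniq.
have sk : k \in s by rewrite mem_nth.
have aik : adj G i k.
  by have := sortedP i Gs _ ks; rewrite nth_index.
have ik := adj_neq aik; have ij' := adj_neq aij.
have kj : k != j by apply: contraTneq gap => <-; rewrite Ek ltnn.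
have ikj : linked G [set j] i k by apply: adj_linked; rewrite ?inE.
have ijk : linked G [set k] i j.
  by apply: adj_linked; rewrite ?inE // eq_sym.
have := bG i k j ik ij' kj; rewrite ikj ijk /=; apply/negP; rewrite negbK.
rewrite -[j in linked _ _ k j](nth_index i sj) linked_nth // => e /andP[ie ej].
rewrite inE; apply: contraTneq ie => E.
by rewrite -(index_uniq i (leq_ltn_trans ej js) us) E ltnn.
Qed.

Lemma between_paths G C : always_between G -> C \in components G ->
  induces_path G C.
Proof.
move=> bG CG; have [s [us Cs Gs]] := between_spanning_path bG CG.
exists s; split=> // i j; rewrite !Cs => si sj.
have back x y : x \in s -> y \in s -> (index x s).+1 = index y s -> adj G x y.
  move=> sx sy e; have := sortedP x Gs (index x s).
  by rewrite e nth_index // nth_index // index_mem; apply.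
apply/idP/orP => [ij|[/eqP|/eqP]]; last 2 first.
- exact: back.
- by rewrite adjC; apply: back.
have := adj_neq ij; case: (ltngtP (index i s) (index j s)) => [lt|gt|e].
- by left; apply/eqP; apply: between_induced lt ij.
- by right; apply/eqP; rewrite adjC in ij; apply: between_induced gt ij.
- by move: (nth_index i si); rewrite e nth_index // => ->; rewrite eqxx.
Qed.

(** A discrete intermediate value argument: a walk in a path graph changes the
    position by one at each step. *)
Lemma path_crosses G C s i p c : C \in components G -> C =i s ->
  {in C &, forall i j, adj G i j =
     ((index i s).+1 == index j s) || ((index j s).+1 == index i s)} ->
  path (adj G) i p -> i \in C -> index i s < c < index (last i p) s ->
  exists2 v, v \in p & index v s = c.
Proof.
move=> CG Cs Es; elim: p i => [|v p IH] i /=.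
  by move=> _ _ /andP[/ltn_trans h /h]; rewrite ltnn.
case/andP=> iv Gp iC /andP[ic cl].
have vC : v \in C by rewrite (mem_component _ CG iC) connect1.
have vc : index v s <= c.
  move: iv; rewrite Es // => /orP[]/eqP e; first by rewrite -e.
  by apply: leq_trans (ltnW ic); rewrite -e.
move: vc; rewrite leq_eqVlt => /predU1P[<-|vc].
  by exists v; rewrite ?inE ?eqxx.
have [w wp <-] := IH v Gp vC (introT andP (conj vc cl)).
by exists w; rewrite // inE wp orbT.
Qed.

Lemma path_separates G C s i j k K : C \in components G -> C =i s ->
  {in C &, forall i j, adj G i j =
     ((index i s).+1 == index j s) || ((index j s).+1 == index i s)} ->
  i \in C -> j \in C -> k \in C ->
  index i s < index k s < index j s -> k \in K -> i \notin K ->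
  ~~ linked G K i j.
Proof.
move=> CG Cs Es iC jC kC ikj kK iK; apply/negP=> /(linkedP iK)[p [Gp _ lp pK]].
rewrite -lp in ikj; have [v vp vk] := path_crosses CG Cs Es Gp iC ikj.
have vip : v \in i :: p by rewrite inE vp orbT.
suff e : v = k by move: (pK v vip); rewrite e kK.
apply: (index_inj i _ _ vk); rewrite -Cs // (mem_component _ CG iC).
by apply: path_connect Gp _ _.
Qed.

(** In an E minor any two of i, j, k are linked outside the third, so all three
    lie in one component; but one of them is the middle one on that path. *)
Lemma paths_UBF G : (forall C, C \in components G -> induces_path G C) ->
  in_class [:: LetU; LetB; LetF] (sep_gaussoid G).
Proof.
move=> paths; apply/in_class_UBF; split=> [|i j k L m].
  exact: sep_graphlike.
have [_ sij] := minor_at_symbols m.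
have [_ sik] := minor_at_symbols (minor_atCr m).
have [_ sjk] := minor_at_symbols (minor_atCr (minor_atC m)).
rewrite /upper_count !mem_sep_gaussoid //.
apply/eqP=> c0.
have [lij lik ljk] : [/\ linked G (k |: L) i j, linked G (j |: L) i k
    & linked G (i |: L) j k].
  by move: c0; do 3?case: (linked _ _ _ _).
have [C CG iC] := component_of G i.
have jC : j \in C by rewrite (mem_component _ CG iC) (linked_connect lij).
have kC : k \in C by rewrite (mem_component _ CG iC) (linked_connect lik).
have [s [us Cs Es]] := paths C CG.
have sep x y z K : sym x y K \in symbols n -> z \in K -> x \in C -> y \in C ->
    z \in C -> linked G K x y ->
    (index x s < index z s < index y s) || (index y s < index z s < index x s)
    = false.
  rewrite sym_symbols => /and3P[_ xK yK] zK xC yC zC lxy.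
  apply/negbTE/norP; split; apply: contraL lxy => h.
    exact: (path_separates CG Cs Es xC yC zC h zK xK).
  by rewrite linkedC; apply: (path_separates CG Cs Es yC xC zC h zK yK).
have neq x y : x != y -> x \in C -> y \in C ->
      (index x s == index y s) = false.
  move=> xy xC yC; apply: contraNF xy => /eqP e.
  by apply/eqP; apply: (index_inj i _ _ e); rewrite -Cs.
have := sep _ _ k _ sij (setU11 _ _) iC jC kC lij.
have := sep _ _ j _ sik (setU11 _ _) iC kC jC lik.
have := sep _ _ i _ sjk (setU11 _ _) jC kC iC ljk.
case/and4P: m => /neq/(_ iC jC) ij /neq/(_ iC kC) ik /neq/(_ jC kC) jk _.
by case: ltngtP ij => // _ _; case: ltngtP ik => // _ _; case: ltngtP jk.
Qed.

Lemma UBF_sep G : in_class [:: LetU; LetB; LetF] (sep_gaussoid G) <->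
  forall C, C \in components G -> induces_path G C.
Proof.
split=> [/UBF_between bG C|]; first exact: between_paths.
exact: paths_UBF.
Qed.

End Paths.

(** * Partitions and complete multipartite graphs *)

Section Partitions.
Variable n : nat.
Implicit Types (A : {set symbol n}) (G H : sgraph n) (i j k : 'I_n)
  (P : {set {set 'I_n}}).

Lemma connect_components G i j :
  connect (adj G) i j = (j \in pblock (components G) i).
Proof.
by rewrite (pblock_equivalence_partition (@connect_adj_equiv n G)) ?in_setT.
Qed.

Lemma adj_compl_cliques G i j :
  (forall C, C \in components (compl G) -> is_clique (compl G) C) ->
  adj (compl G) i j = (i != j) && (j \in pblock (components (compl G)) i).
Proof.
move=> cl; rewrite -connect_components; apply/idP/andP => [ij|[ij cij]].
  by rewrite (adj_neq ij) connect1.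
have [C CG iC] := component_of (compl G) i.
by apply: (cl C CG) => //; rewrite (mem_component _ CG iC).
Qed.

(** If the components of a graph are cliques, its edges are the pairs of
    distinct vertices in a common component. *)
Lemma cliques_components_inj G H :
  (forall C, C \in components (compl G) -> is_clique (compl G) C) ->
  (forall C, C \in components (compl H) -> is_clique (compl H) C) ->
  components (compl G) = components (compl H) -> G = H.
Proof.
move=> clG clH GH; apply: sgraph_eq => i j.
have [->|ij] := eqVneq i j.
  by rewrite !(contraTF (@adj_neq _ _ j j)) ?eqxx.
have := adj_compl_cliques i j clG; have := adj_compl_cliques i j clH.
by rewrite GH => <-; rewrite !adj_compl ij => /negb_inj.
Qed.

Lemma multipartite_card2 P :
  [forall e in [set e : {set 'I_n} |
      (#|e| == 2) && ~~ [exists B in P, e \subset B]], #|e| == 2].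
Proof. by apply/forall_inP => e; rewrite inE => /andP[]. Qed.

Definition multipartite P : sgraph n := SGraph (multipartite_card2 P).

Lemma adj_compl_multipartite P i j : partition P [set: 'I_n] ->
  adj (compl (multipartite P)) i j = (i != j) && (j \in pblock P i).
Proof.
move=> partP; have /and3P[/eqP cov triv _] := partP.
rewrite adj_compl /adj inE cards2; have [|_] //= := eqVneq i j.
rewrite negbK; apply/exists_inP/idP=> [[B BP]|ij].
  by rewrite subUset !sub1set => /andP[iB]; rewrite (def_pblock triv BP iB).
exists (pblock P i); first by rewrite pblock_mem // cov in_setT.
by rewrite subUset !sub1set ij mem_pblock cov in_setT.
Qed.

Lemma connect_compl_multipartite P i j : partition P [set: 'I_n] ->
  connect (adj (compl (multipartite P))) i j = (j \in pblock P i).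
Proof.
move=> partP; have /and3P[/eqP cov triv _] := partP.
have icov x : x \in cover P by rewrite cov in_setT.
apply/idP/idP=> [/connectP[p + ->]|ij].
  elim: p i => [|v p IH] i /=; first by rewrite mem_pblock.
  rewrite adj_compl_multipartite // => /andP[/andP[_ iv] /IH].
  by rewrite (same_pblock triv iv).
have [->|neq] := eqVneq i j; first exact: connect0.
by apply: connect1; rewrite adj_compl_multipartite // neq.
Qed.

Lemma components_multipartite P : partition P [set: 'I_n] ->
  components (compl (multipartite P)) = P.
Proof.
move=> partP; rewrite -[RHS](equivalence_partition_pblock partP).
apply: eq_imset => x; apply/setP=> y.
by rewrite !inE connect_compl_multipartite.
Qed.

Lemma multipartite_cliques P C : partition P [set: 'I_n] ->
  C \in components (compl (multipartite P)) ->
  is_clique (compl (multipartite P)) C.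
Proof.
move=> partP CP i j iC jC ij; rewrite adj_compl_multipartite // ij /=.
by rewrite -connect_compl_multipartite // -(mem_component _ CP iC).
Qed.

(** Reduces the description of a subclass to graphs: its members are graphlike,
    hence come from a graph. *)
Lemma sep_gaussoid_class ts A (Q : sgraph n -> Prop) :
  (in_class ts A -> graphlike A) ->
  (forall G, in_class ts (sep_gaussoid G) <-> Q G) ->
  in_class ts A <-> exists2 G, A = sep_gaussoid G & Q G.
Proof.
move=> gA tsQ; split=> [cA|[G -> /tsQ //]].
have [G EG] := (graphlikeE A).1 (gA cA).
by exists G => //; apply/tsQ; rewrite -EG.
Qed.

End Partitions.

Theorem theorem4p4 (n : nat) (hn : 3 <= n) :
  (* G |-> <<G>> is a bijection from graphs onto the EUBF gaussoids *)
  (injective (@sep_gaussoid n) /\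
   forall A : {set symbol n},
     (gaussoid A /\ in_class [:: LetE; LetU; LetB; LetF] A)
     <-> exists G : sgraph n, A = sep_gaussoid G) /\
  (forall A : {set symbol n},
     in_class [:: LetE; LetU; LetB] A
     <-> exists2 G : sgraph n, A = sep_gaussoid G & triangle_free (compl G)) /\
  (forall A : {set symbol n},
     in_class [:: LetU; LetB; LetF] A
     <-> exists2 G : sgraph n, A = sep_gaussoid G &
           forall C, C \in components G -> induces_path G C) /\
  ((forall A : {set symbol n},
     in_class [:: LetE; LetU; LetF] A
     <-> exists2 G : sgraph n, A = sep_gaussoid G &
           forall C, C \in components (compl G) -> is_clique (compl G) C) /\
   (* these gaussoids correspond bijectively to partitions of the vertex set *)
   (forall A : {set symbol n}, in_class [:: LetE; LetU; LetF] A ->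
      exists! P : {set {set 'I_n}}, partition_of A P) /\
   (forall P : {set {set 'I_n}}, partition P [set: 'I_n] ->
      exists! A : {set symbol n},
        in_class [:: LetE; LetU; LetF] A /\ partition_of A P)) /\
  (forall A : {set symbol n},
     in_class [:: LetE; LetU] A
     <-> exists2 G : sgraph n, A = sep_gaussoid G &
           forall C, C \in components (compl G) ->
             is_clique (compl G) C /\ #|C| <= 2).
Proof.
have EUF (G : sgraph n) : in_class [:: LetE; LetU; LetF] (sep_gaussoid G) <->
    forall C, C \in components (compl G) -> is_clique (compl G) C.
  by rewrite EUF_sep cotransitive_cliques.
split; [split|split; [|split; [|split; [split; [|split]|]]]].
- exact: sep_gaussoid_inj.
- move=> A; rewrite graphlike_EUBF -graphlikeE.
  by split=> [[]|gA] //; split=> //; apply: graphlike_gaussoid.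
- move=> A; apply: sep_gaussoid_class => [/in_class_EUB[]//|G].
  exact: EUB_sep.
- move=> A; apply: sep_gaussoid_class => [/in_class_UBF[]//|G].
  exact: UBF_sep.
- by move=> A; apply: sep_gaussoid_class => [/in_class_EUF[]|].
- move=> A /in_class_EUF[/graphlikeE[G AG] _].
  exists (components (compl G)); split.
    by split; [apply: components_partition|exists G].
  by move=> P [_ [H AH <-]]; congr (components (compl _));
    apply: sep_gaussoid_inj; rewrite -AG.
- move=> P partP; exists (sep_gaussoid (multipartite P)); split.
    split; first by apply/EUF=> C; apply: multipartite_cliques.
    split=> //; exists (multipartite P) => //.
    exact: components_multipartite.
  move=> A [+ [_ [H AH HP]]]; rewrite AH => /EUF clH.
  congr sep_gaussoid; apply: cliques_components_inj clH _.
    by move=> C; apply: multipartite_cliques.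
  by rewrite components_multipartite.
- move=> A; apply: sep_gaussoid_class => [|G]; last exact: EU_sep.
  by case/in_class_EU=> /in_class_EUB[].
Qed.
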